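(* Let $\mathcal{H}\subseteq\mathcal{K}$ be complex Hilbert spaces, let $T\in\mathcal{B}(\mathcal{H})$ be a contraction and let $V\in\mathcal{B}(\mathcal{K})$ be an isometric lifting of $T$. Let $X\in\mathcal{B}(\mathcal{H})$. Let $Q\in\mathcal{B}(\mathcal{H})$ and $\overline{Q}\in\mathcal{B}(\mathcal{K})$ be contractions such that $\mathcal{H}$ reduces $\overline{Q}$ and $\overline{Q}|_{\mathcal{H}}=Q$. (i) If $XT=QTX$, then there exists a lifting $Y\in\mathcal{B}(\mathcal{K})$ of $X$ such that $YV=\overline{Q}VY$. (ii) If $XT=TQX$, then there exists a lifting $Y\in\mathcal{B}(\mathcal{K})$ of $X$ such that $YV=V\overline{Q}Y$. (iii) If moreover $Q$ and $\overline{Q}$ are unitary and $XT=TXQ$, then there exists a lifting $Y\in\mathcal{B}(\mathcal{K})$ of $X$ such that $YV=VY\overline{Q}$. In all cases $T^nX^m=P_{\mathcal{H}}V^nY^m|_{\mathcal{H}}$ and $X^nT^m=P_{\mathcal{H}}Y^nV^m|_{\mathcal{H}}$ for all integers $n,m\geq 0$, and $Y$ can be chosen such that $\|Y\|=\|X\|$.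
   Context: For Hilbert spaces $\mathcal{H}\subseteq\mathcal{K}$, $S\in\mathcal{B}(\mathcal{K})$ is a lifting of $T\in\mathcal{B}(\mathcal{H})$ if $S(\mathcal{H}^\perp)\subseteq\mathcal{H}^\perp$ and $T=P_{\mathcal{H}}S|_{\mathcal{H}}$ (equivalently $S^*|_{\mathcal{H}}=T^*$); an isometric lifting of $T$ is a lifting that is an isometry. $P_{\mathcal{H}}$ is the orthogonal projection onto $\mathcal{H}$. *)

(* Defs.v *)
From HB Require Import structures.
From mathcomp Require Import all_boot all_order all_algebra.
From mathcomp Require Import classical_sets reals.
From mathcomp Require Import complex.

Set Implicit Arguments.
Unset Strict Implicit.
Unset Printing Implicit Defensive.

Import Order.TTheory GRing.Theory Num.Theory.
Local Open Scope ring_scope.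

Section Hilbert.
Variable R : realType.
Local Notation C := (complex R).
Variable K : lmodType C.
Variable ip : K -> K -> C.   (* inner product, linear in the first argument *)

Definition hnorm (x : K) : R := Num.sqrt (complex.Re (ip x x)).

Definition cauchy_seq (u : nat -> K) : Prop :=
  forall e : R, 0 < e -> exists N : nat, forall m n : nat,
    (N <= m)%N -> (N <= n)%N -> hnorm (u m - u n) < e.

Definition converges_to (u : nat -> K) (l : K) : Prop :=
  forall e : R, 0 < e -> exists N : nat, forall n : nat,
    (N <= n)%N -> hnorm (u n - l) < e.

Definition is_hilbert : Prop :=
  [/\ (forall (a : C) (x y z : K), ip (a *: x + y) z = a * ip x z + ip y z),
      (forall x y : K, ip y x = Num.conj (ip x y)),
      (forall x : K, 0 <= ip x x),
      (forall x : K, ip x x = 0 -> x = 0)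
    & (forall u : nat -> K, cauchy_seq u -> exists l : K, converges_to u l)].

Definition closed_subspace (H : set K) : Prop :=
  [/\ H 0,
      (forall x y : K, H x -> H y -> H (x + y)),
      (forall (a : C) (x : K), H x -> H (a *: x))
    & (forall (u : nat -> K) (l : K), (forall n, H (u n)) -> converges_to u l -> H l)].

Definition orth (H : set K) : set K := [set x | forall h, H h -> ip x h = 0].

Definition is_proj (H : set K) (x y : K) : Prop := H y /\ orth H (x - y).

(* A : K -> K, considered only on H, is a bounded linear operator on H *)
Definition bounded_op_on (H : set K) (A : K -> K) : Prop :=
  [/\ (forall h, H h -> H (A h)),
      (forall (a : C) (x y : K), H x -> H y -> A (a *: x + y) = a *: A x + A y)
    & exists M : R, forall h, H h -> hnorm (A h) <= M * hnorm h].

Definition bounded_op (A : K -> K) : Prop := bounded_op_on setT A.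

Definition contraction_on (H : set K) (A : K -> K) : Prop :=
  bounded_op_on H A /\ forall h, H h -> hnorm (A h) <= hnorm h.

Definition isometry_on (H : set K) (A : K -> K) : Prop :=
  bounded_op_on H A /\ forall h, H h -> hnorm (A h) = hnorm h.

Definition unitary_on (H : set K) (A : K -> K) : Prop :=
  isometry_on H A /\ forall h, H h -> exists2 g, H g & A g = h.

Definition opnorm_on (H : set K) (A : K -> K) : R :=
  sup [set hnorm (A h) | h in [set h | H h /\ hnorm h <= 1]].

Definition lifting (H : set K) (S T : K -> K) : Prop :=
  (forall x, orth H x -> orth H (S x)) /\
  (forall h, H h -> is_proj H (S h) (T h)).

Definition reduces (H : set K) (A : K -> K) : Prop :=
  (forall h, H h -> H (A h)) /\ (forall x, orth H x -> orth H (A x)).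

End Hilbert.

(* Main.v *)
(** All three parts are instances of one lifting problem.  Let [V] be an isometry
    lifting [T], let [B] be a contraction on the whole space lifting [A], and let
    [X T = A X]; then some lifting [Y] of [X] with [Y V = B Y] has the norm [g] of
    [X].  In (i) take [B = Qb V], in (ii) [B = V Qb]; in (iii) the isometry is
    [V Qb^-1] and [B = V].

    With [W = X P], [P] the projection onto [H], the lifting is the series
    [Y k = W k + \sum_n B^n (G_n.+1 k)], whose coefficients take values in the
    orthogonal complement of [H] and satisfy [G_0 = (B - A) W] and
    [G_n.+1 V = G_n].  The last equation prescribes [G_n.+1] on the range of [V];
    it is extended to the whole space through the orthogonal projection for the
    semi-inner product [q_n] that measures the slack left in the norm bound,
    [q_0 = g^2 |k|^2 - |W k|^2].  The squared norm of the n-th layer in the defect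
    space of [A] is carried along as a form [r_n], with
    [r_0 = |W k|^2 - |A W k|^2] and [q_n.+1 = q_n - r_n.+1], which avoids
    constructing the defect space.  Projections for [q_n] are only approximated,
    since the space need not be complete for [q_n].

    Forms are real parts of sesquilinear forms, so that limits of forms are limits
    of real numbers. *)
Require Import Defs.
From HB Require Import structures.
From mathcomp Require Import all_boot all_order all_algebra.
From mathcomp Require Import boolp classical_sets reals.
From mathcomp Require Import complex.
From mathcomp Require Import ring lra.
Set Implicit Arguments.
Unset Strict Implicit.
Unset Printing Implicit Defensive.
Import Order.TTheory GRing.Theory Num.Theory.
Local Open Scope ring_scope.
Local Open Scope complex_scope.
Local Open Scope classical_set_scope.

(** * Real inequalities that stand in for limits *)

Section RealLemmas.
Variable R : realType.
Implicit Types x y a b c e M : R.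

(** Passage to the limit as [e] tends to 0. The restriction [e <= 1] lets callers absorb [e ^+ 2]
    into the linear error term. *)
Lemma le_of_le_small x y M :
  (forall e, 0 < e -> e <= 1 -> x <= y + e * M) -> x <= y.
Proof.
move=> h; rewrite leNgt; apply/negP => yx.
have M1 : 0 < `|M| + 1 by have := normr_ge0 M; lra.
set e := Num.min 1 ((x - y) / (`|M| + 1) / 2).
have e0 : 0 < e by rewrite lt_min ltr01 /= !divr_gt0 // subr_gt0.
have e1 : e <= 1 by rewrite ge_min lexx.
have e2 : e * (`|M| + 1) <= (x - y) / 2.
  have -> : (x - y) / 2 = (x - y) / (`|M| + 1) / 2 * (`|M| + 1).
    by field; rewrite gt_eqF.
  by rewrite ler_pM2r // ge_min lexx orbT.
have := h e e0 e1; have := ler_norm M; nra.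
Qed.

Lemma eq_of_dist_small x y M :
  (forall e, 0 < e -> e <= 1 -> `|x - y| <= e * M) -> x = y.
Proof.
move=> h; apply/eqP; rewrite eq_le; apply/andP; split;
  apply: (@le_of_le_small _ _ M) => e e0 e1; have := h e e0 e1;
  rewrite ler_norml; lra.
Qed.

Lemma discr_le a b c :
  (forall t, 0 <= c - 2 * t * b + t ^+ 2 * a) -> 0 <= a -> b ^+ 2 <= a * c.
Proof.
move=> h; rewrite le_eqVlt => /orP[/eqP a0|a0].
  rewrite -a0 in h *; rewrite mul0r; suff -> : b = 0 by rewrite expr0n.
  apply/eqP; apply: contraT => b0.
  (* For [a = 0] the polynomial is affine in [t]; this [t] gives it the value -1. *)
  have := h ((c + 1) / (2 * b)).
  suff -> : c - 2 * ((c + 1) / (2 * b)) * b + ((c + 1) / (2 * b)) ^+ 2 * 0 = - 1.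
    by rewrite ler0N1.
  by field.
(* The minimiser of the quadratic. *)
have := h (b / a).
have -> : c - 2 * (b / a) * b + (b / a) ^+ 2 * a = (a * c - b ^+ 2) / a.
  by field; rewrite gt_eqF.
by rewrite pmulr_lge0 ?invr_gt0 // subr_ge0.
Qed.

Lemma ler_sqrtl x y : 0 <= y -> x <= y ^+ 2 -> Num.sqrt x <= y.
Proof. by move=> y0 h; rewrite -(ger0_norm y0) -sqrtr_sqr ler_wsqrtr. Qed.

(** Completeness of the reals for an arbitrary index type, so that limits along approximations can
    be taken without choosing a sequence. *)
Lemma nested_intervals (I : Type) (P : I -> Prop) (l u : I -> R) (i0 : I) :
  P i0 -> (forall i j, P i -> P j -> l i <= u j) ->
  exists c, forall i, P i -> l i <= c <= u i.
Proof.
move=> Pi0 h; exists (sup [set l i | i in P]) => i Pi; apply/andP; split.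
  apply: ub_le_sup; last by exists i.
  by exists (u i0) => _ [j Pj <-]; apply: h.
by apply: ge_sup => [|_ [j Pj <-]]; [exists (l i0), i0 | apply: h].
Qed.

End RealLemmas.

(** * Real parts of Hermitian forms, and maps linear on a subspace *)

Section Forms.
Variables (R : realType) (K : lmodType (complex R)).
Implicit Types (b : K -> K -> R) (x y z : K).

(** [formJ] carries the complex structure: scaling by [c] has scaling by its conjugate as adjoint.
    The imaginary part of the underlying Hermitian form is recovered as [b x ('i *: y)]. *)
Record rform b : Prop := Form {
  formDl : forall x y z, b (x + y) z = b x z + b y z;
  formC : forall x y, b x y = b y x;
  formJ : forall (c : complex R) x y, b (c *: x) y = b x (c^* *: y);
  formZl : forall (a : R) x y, b (a%:C *: x) y = a * b x y }.

Definition psd b := forall x, 0 <= b x x.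

Definition nrm b x := Num.sqrt (b x x).

Section FormTheory.
Variables (b : K -> K -> R) (bf : rform b).

Lemma formDr x y z : b x (y + z) = b x y + b x z.
Proof. by rewrite formC // formDl // !(formC bf x). Qed.

Lemma form0l y : b 0 y = 0.
Proof. by have := formDl bf 0 0 y; rewrite addr0; lra. Qed.

Lemma formNl x y : b (- x) y = - b x y.
Proof. by have := formDl bf x (- x) y; rewrite subrr form0l; lra. Qed.

Lemma formNr x y : b x (- y) = - b x y.
Proof. by rewrite formC // formNl formC. Qed.

Lemma formBl x y z : b (x - y) z = b x z - b y z.
Proof. by rewrite formDl // formNl. Qed.

Lemma formBr x y z : b x (y - z) = b x y - b x z.
Proof. by rewrite formDr formNr. Qed.

Lemma formZr (a : R) x y : b x (a%:C *: y) = a * b x y.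
Proof. by rewrite formC // formZl // formC. Qed.

Lemma form_sqrD x y : b (x + y) (x + y) = b x x + 2 * b x y + b y y.
Proof. by rewrite formDl // !formDr (formC bf y x); ring. Qed.

Lemma form_sqrB x y : b (x - y) (x - y) = b x x - 2 * b x y + b y y.
Proof. by rewrite formBl !formBr (formC bf y x); ring. Qed.

Lemma form_sqrZ (c : complex R) x : b (c *: x) (c *: x) = (Normc.normc c) ^+ 2 * b x x.
Proof.
rewrite formJ // scalerA.
have -> : c^* * c = ((Normc.normc c) ^+ 2)%:C.
  case: c => u v; rewrite /= sqr_sqrtr ?addr_ge0 ?sqr_ge0 //.
  by apply/eqP; rewrite eq_complex /=; apply/andP; split; apply/eqP; ring.
by rewrite formZr.
Qed.

Hypothesis b0 : psd b.

Lemma nrm_ge0 x : 0 <= nrm b x. Proof. exact: sqrtr_ge0. Qed.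

Lemma sqr_nrm x : nrm b x ^+ 2 = b x x.
Proof. by rewrite sqr_sqrtr. Qed.

Lemma form_CS x y : `|b x y| <= nrm b x * nrm b y.
Proof.
rewrite -(@ler_pXn2r _ 2) ?nnegrE ?mulr_ge0 ?nrm_ge0 //.
rewrite exprMn !sqr_nrm real_normK ?num_real // mulrC.
apply: discr_le => // t.
have := b0 (x - t%:C *: y).
by rewrite form_sqrB !formZr (formZl bf); lra.
Qed.

Lemma form_le x y : b x y <= nrm b x * nrm b y.
Proof. exact: le_trans (ler_norm _) (form_CS x y). Qed.

Lemma nrmD x y : nrm b (x + y) <= nrm b x + nrm b y.
Proof.
apply: ler_sqrtl; first by rewrite addr_ge0 ?nrm_ge0.
by rewrite form_sqrD sqrrD !sqr_nrm; have := form_le x y; lra.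
Qed.

Lemma nrmN x : nrm b (- x) = nrm b x.
Proof. by rewrite /nrm formNl formNr opprK. Qed.

Lemma nrmB x y : nrm b (x - y) = nrm b (y - x).
Proof. by rewrite -nrmN opprB. Qed.

Lemma nrm0 : nrm b 0 = 0.
Proof. by rewrite /nrm form0l sqrtr0. Qed.

Lemma nrmZ (c : complex R) x : nrm b (c *: x) = Normc.normc c * nrm b x.
Proof.
rewrite /nrm form_sqrZ sqrtrM ?sqr_ge0 // sqrtr_sqr ger0_norm //.
by case: c => u v; apply: sqrtr_ge0.
Qed.

End FormTheory.

Lemma formB b b' : rform b -> rform b' -> rform (fun x y => b x y - b' x y).
Proof.
move=> bf bf'; split=> [x y z|x y|c x y|a x y].
- by rewrite !formDl //; ring.
- by rewrite formC // (formC bf').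
- by rewrite (formJ bf) (formJ bf').
- by rewrite !formZl //; ring.
Qed.

Lemma form_scale (r : R) b : rform b -> rform (fun x y => r * b x y).
Proof.
move=> bf; split=> [x y z|x y|c x y|a x y].
- by rewrite !formDl //; ring.
- by rewrite formC.
- by rewrite (formJ bf).
- by rewrite !formZl //; ring.
Qed.

Definition linear_on (D : set K) (f : K -> K) := forall (a : complex R) x y,
  D x -> D y -> f (a *: x + y) = a *: f x + f y.

Definition subspace (D : set K) :=
  D 0 /\ forall (a : complex R) x y, D x -> D y -> D (a *: x + y).

Lemma subspaceT : subspace setT. Proof. by []. Qed.

Section LinearOn.
Variables (D : set K) (f : K -> K).
Hypotheses (sD : subspace D) (lf : linear_on D f).

Lemma subspaceZ (a : complex R) x : D x -> D (a *: x).
Proof. by case: sD => D0 DD Dx; rewrite -[_ *: _]addr0; apply: DD. Qed.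

Lemma subspaceD x y : D x -> D y -> D (x + y).
Proof. by case: sD => D0 DD Dx; rewrite -[x]scale1r; apply: DD. Qed.

Lemma subspaceB x y : D x -> D y -> D (x - y).
Proof. by move=> Dx Dy; apply: subspaceD => //; rewrite -scaleN1r; apply: subspaceZ. Qed.

Lemma linear_on0 : f 0 = 0.
Proof.
case: sD => D0 _; have := lf (-1) D0 D0.
by rewrite scaler0 addr0 scaleN1r addNr.
Qed.

Lemma linear_onZ (a : complex R) x : D x -> f (a *: x) = a *: f x.
Proof.
case: sD => D0 _ Dx; have := lf a Dx D0.
by rewrite linear_on0 !addr0.
Qed.

Lemma linear_onD x y : D x -> D y -> f (x + y) = f x + f y.
Proof. by move=> Dx Dy; have := lf 1 Dx Dy; rewrite !scale1r. Qed.

Lemma linear_onB x y : D x -> D y -> f (x - y) = f x - f y.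
Proof.
move=> Dx Dy; rewrite -(scaleN1r y) linear_onD ?linear_onZ ?scaleN1r //.
by rewrite -scaleN1r; apply: subspaceZ.
Qed.

End LinearOn.

Lemma form_comp b f : rform b -> linear_on setT f ->
  rform (fun x y => b (f x) (f y)).
Proof.
move=> bf lf; split=> [x y z|x y|c x y|a x y].
- by rewrite (linear_onD lf) // formDl.
- by rewrite formC.
- by rewrite !(linear_onZ subspaceT lf) // (formJ bf).
- by rewrite (linear_onZ subspaceT lf) // formZl.
Qed.

End Forms.

(** * Approximate orthogonal projections for a semi-inner product *)

Section Approx.
Variables (R : realType) (K : lmodType (complex R)).
Variables (D : set K) (f : K -> K) (q : K -> K -> R).
Hypotheses (sD : subspace D) (lf : linear_on D f).
Hypotheses (qf : rform q) (q0 : psd q).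
Implicit Types (k l s : K) (e : R).

(* [f l] is, up to [e], the [q]-orthogonal projection of [k] onto [f @` D]. *)
Definition approx e k l :=
  D l /\ forall s, D s -> `|q (k - f l) (f s)| <= e * nrm q (f s).

Lemma approxW e e' k l : e <= e' -> approx e k l -> approx e' k l.
Proof.
move=> ee' [Dl h]; split=> // s Ds; apply: le_trans (h s Ds) _.
by rewrite ler_wpM2r ?nrm_ge0.
Qed.

(** A near-minimiser of the [q]-distance from [k] to the image works: moving it along [s] gains at
    most [e ^+ 2], and the discriminant inequality turns this into near-orthogonality with tolerance
    [e]. *)
Lemma approx_ex e k : 0 < e -> exists l, approx e k l.
Proof.
move=> e0; set E := [set q (k - f l) (k - f l) | l in D].
have Einf : has_inf E.
  by split; [exists (q (k - f 0) (k - f 0)), 0 => //; case: sD | exists 0 => _ [l _ <-]].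
have [_ [l Dl <-] hl] := inf_adherent (exprn_gt0 2 e0) Einf.
exists l; split=> // s Ds.
rewrite -(@ler_pXn2r _ 2) ?nnegrE ?mulr_ge0 ?nrm_ge0 ?(ltW e0) //.
rewrite exprMn sqr_nrm // real_normK ?num_real // mulrC.
apply: discr_le => // t.
have Dt : D (t%:C *: s) by apply: subspaceZ.
have : inf E <= q (k - f (l + t%:C *: s)) (k - f (l + t%:C *: s)).
  apply: ge_inf; first by case: Einf.
  by exists (l + t%:C *: s) => //; apply: subspaceD.
rewrite (linear_onD lf) // opprD addrA (linear_onZ sD lf) //.
by rewrite form_sqrB // formZr // (formZl qf) formZr // expr2; lra.
Qed.

(** The scalar [c] is moved onto the test vector by [formJ]; its conjugate has the same modulus. *)
Lemma approx_lin e e' (c : complex R) k k' l l' :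
  approx e k l -> approx e' k' l' ->
  approx (Normc.normc c * e + e') (c *: k + k') (c *: l + l').
Proof.
move=> [Dl h] [Dl' h']; split=> [|s Ds]; first by case: sD => _; apply.
rewrite lf // opprD addrACA -scalerBr (formDl qf) (formJ qf).
rewrite -(linear_onZ sD lf) //; apply: le_trans (ler_normD _ _) _.
rewrite mulrDl lerD ?h' //.
have := h _ (subspaceZ sD c^* Ds).
rewrite (linear_onZ sD lf) // nrmZ //.
suff -> : Normc.normc c^* = Normc.normc c by rewrite mulrCA mulrA.
by case: c => u v /=; rewrite sqrrN.
Qed.

Lemma approx_ex_lin e (c : complex R) k k' : 0 < e -> exists l l',
  [/\ approx e k l, approx e k' l' & approx e (c *: k + k') (c *: l + l')].
Proof.
move=> e0; set n := Normc.normc c.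
have n0 : 0 <= n by rewrite /n; case: (c) => u v; apply: sqrtr_ge0.
set d := e / (n + 1).
have d0 : 0 < d by rewrite divr_gt0 // ltr_wpDl.
have de : n * d + d = e by rewrite /d; field; rewrite gt_eqF // ltr_wpDl.
have [l al] := approx_ex k d0; have [l' al'] := approx_ex k' d0.
have de' : d <= e by rewrite -de lerDr mulr_ge0 // ltW.
exists l, l'; split; try exact: approxW de' _.
by rewrite -de; apply: approx_lin.
Qed.

(** [f (l - l')] is the difference of the two residuals, and each residual is nearly orthogonal to
    it. *)
Lemma approx_diff e e' k l l' :
  0 <= e -> 0 <= e' -> approx e k l -> approx e' k l' ->
  nrm q (f (l - l')) <= e + e'.
Proof.
move=> e0 e0' [Dl h] [Dl' h'].
have Dll : D (l - l') by apply: subspaceB.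
have [->|n0] := eqVneq (nrm q (f (l - l'))) 0; first by rewrite addr_ge0.
have np : 0 < nrm q (f (l - l')) by rewrite lt_def n0 nrm_ge0.
rewrite -(ler_pM2r np) -expr2 sqr_nrm //.
have {1}-> : f (l - l') = (k - f l') - (k - f l).
  by rewrite (linear_onB sD lf) // opprB [RHS]addrC addrA subrK.
rewrite (formBl qf).
have := h _ Dll; have := h' _ Dll; rewrite !ler_norml mulrDl; lra.
Qed.

Lemma approx_bound e k l : 0 <= e -> approx e k l -> nrm q (f l) <= nrm q k + e.
Proof.
move=> e0 [Dl h].
have [->|n0] := eqVneq (nrm q (f l)) 0; first by rewrite addr_ge0 ?nrm_ge0.
have np : 0 < nrm q (f l) by rewrite lt_def n0 nrm_ge0.
rewrite -(ler_pM2r np) -expr2 sqr_nrm // mulrDl.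
have -> : q (f l) (f l) = q k (f l) - q (k - f l) (f l) by rewrite (formBl qf); ring.
have := h _ Dl; have := form_le qf q0 k (f l); rewrite ler_norml; lra.
Qed.

End Approx.

(** * Transport of a form along an approximate projection onto the range of [V] *)

Section FormLimit.
Variables (R : realType) (K : lmodType (complex R)).
Variables (V : K -> K) (q r : K -> K -> R).
Hypotheses (lV : linear_on setT V) (qf : rform q) (q0 : psd q).
Hypotheses (rf : rform r) (r0 : psd r) (rq : forall l, r l l <= q (V l) (V l)).

Let approxV := approx setT V q.

Lemma nrm_le_nrmV l : nrm r l <= nrm q (V l).
Proof. exact: ler_wsqrtr. Qed.

(** The intervals centred at [r l l'] with radius [e * M] meet pairwise, because [r] is dominated by
    [q] on the range of [V] and approximate projections of one vector are [q]-close. A common point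
    is the limit. *)
Lemma form_lim_ex k k' : exists c, forall e, 0 < e -> e <= 1 -> forall l l',
  approxV e k l -> approxV e k' l' ->
  `|r l l' - c| <= e * (nrm q k + nrm q k' + 2).
Proof.
set M := nrm q k + nrm q k' + 2.
pose P (i : R * (K * K)) := [/\ 0 < i.1, i.1 <= 1, approxV i.1 k i.2.1 &
  approxV i.1 k' i.2.2].
have [l0 al0] := approx_ex (subspaceT _) lV qf q0 k (@ltr01 R).
have [l0' al0'] := approx_ex (subspaceT _) lV qf q0 k' (@ltr01 R).
have Pi0 : P (1, (l0, l0')) by split.
have [|c hc] := @nested_intervals R _ P (fun i => r i.2.1 i.2.2 - i.1 * M)
    (fun i => r i.2.1 i.2.2 + i.1 * M) _ Pi0; last first.
  exists c => e e0 e1 l l' al al'.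
  have /hc /= : P (e, (l, l')) by [].
  by rewrite ler_norml; lra.
move=> [e [l l']] [d [m m']] [/= e0 e1 al al'] [/= d0 d1 am am'].
have -> : r l l' = r (l - m) l' + r m (l' - m') + r m m'.
  by rewrite (formBl rf) (formBr rf); ring.
have h1 := form_le rf r0 (l - m) l'; have h2 := form_le rf r0 m (l' - m').
have n1 : nrm r (l - m) <= e + d.
  apply: le_trans (nrm_le_nrmV _) _.
  by apply: (approx_diff (subspaceT _) lV qf q0 _ _ al am); exact: ltW.
have n2 : nrm r (l' - m') <= e + d.
  apply: le_trans (nrm_le_nrmV _) _.
  by apply: (approx_diff (subspaceT _) lV qf q0 _ _ al' am'); exact: ltW.
have n3 : nrm r l' <= nrm q k' + 1.
  apply: le_trans (nrm_le_nrmV _) (le_trans (approx_bound qf q0 (ltW e0) al') _).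
  by rewrite lerD2l.
have n4 : nrm r m <= nrm q k + 1.
  apply: le_trans (nrm_le_nrmV _) (le_trans (approx_bound qf q0 (ltW d0) am) _).
  by rewrite lerD2l.
have {}h1 : r (l - m) l' <= (e + d) * (nrm q k' + 1).
  by apply: le_trans h1 _; apply: ler_pM => //; exact: nrm_ge0.
have {}h2 : r m (l' - m') <= (nrm q k + 1) * (e + d).
  by apply: le_trans h2 _; apply: ler_pM => //; exact: nrm_ge0.
by rewrite /M; lra.
Qed.

Lemma approx_ex_scale e (c : complex R) k : 0 < e ->
  exists l, approxV e k l /\ approxV e (c *: k) (c *: l).
Proof.
move=> e0; set n := Normc.normc c.
have n0 : 0 <= n by rewrite /n; case: (c) => u v; apply: sqrtr_ge0.
set d := e / (n + 1).
have d0 : 0 < d by rewrite divr_gt0 // ltr_wpDl.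
have de : n * d + d = e by rewrite /d; field; rewrite gt_eqF // ltr_wpDl.
have [l al] := approx_ex (subspaceT _) lV qf q0 k d0.
have nd : 0 <= n * d by rewrite mulr_ge0 // ltW.
(* The zero vector is its own projection with tolerance 0, so scaling is a case of [approx_lin]. *)
have a00 : approxV 0 0 0.
  split=> // s _; rewrite (linear_on0 (subspaceT _) lV) subrr (form0l qf).
  by rewrite normr0 mul0r.
exists l; split.
  by apply: approxW al => //; rewrite -de lerDr.
have := approx_lin (subspaceT _) lV qf c al a00.
by rewrite !addr0; apply: approxW => //; rewrite -de lerDl ltW.
Qed.

(** Informally [r'] is [r] evaluated at the preimages under [V] of the [q]-projections onto the
    range of [V]. Each property is checked on approximations and passed to the limit; the last
    clause keeps the rate of convergence. *)
Lemma form_lim : exists r' : K -> K -> R,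
  [/\ rform r', psd r', (forall k, r' k k <= q k k),
      (forall k, r' (V k) (V k) = r k k)
   & forall e k l, 0 < e -> e <= 1 -> approxV e k l ->
      `|r l l - r' k k| <= e * (nrm q k + nrm q k + 2)].
Proof.
pose M k k' := nrm q k + nrm q k' + 2.
have [r' hr'] : exists r' : K -> K -> R, forall k k' e, 0 < e -> e <= 1 ->
    forall l l', approxV e k l -> approxV e k' l' ->
    `|r l l' - r' k k'| <= e * M k k'.
  have [g hg] := choice (fun p : K * K => form_lim_ex p.1 p.2).
  by exists (fun k k' => g (k, k')) => k k'; apply: (hg (k, k')).
have ex k e : 0 < e -> exists l, approxV e k l.
  exact: (approx_ex (subspaceT _) lV qf q0 k).
exists r'; split.
- split=> [x y z|x y|c x y|a x y].
  + apply: (@eq_of_dist_small _ _ _ (M (x + y) z + M x z + M y z)) => e e0 e1.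
    have [l [l' [al al']]] := approx_ex_lin (subspaceT _) lV qf q0 1 x y e0.
    rewrite !scale1r => all; have [m am] := ex z e e0.
    have := hr' _ _ _ e0 e1 _ _ al am; have := hr' _ _ _ e0 e1 _ _ al' am.
    have := hr' _ _ _ e0 e1 _ _ all am; rewrite (formDl rf) !ler_norml; lra.
  + apply: (@eq_of_dist_small _ _ _ (M x y + M y x)) => e e0 e1.
    have [l al] := ex x e e0; have [m am] := ex y e e0.
    have := hr' _ _ _ e0 e1 _ _ al am; have := hr' _ _ _ e0 e1 _ _ am al.
    rewrite (formC rf m l) !ler_norml; lra.
  + apply: (@eq_of_dist_small _ _ _ (M (c *: x) y + M x (c^* *: y))) => e e0 e1.
    have [l [al al']] := approx_ex_scale c x e0.
    have [m [am am']] := approx_ex_scale c^* y e0.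
    have := hr' _ _ _ e0 e1 _ _ al' am; have := hr' _ _ _ e0 e1 _ _ al am'.
    rewrite (formJ rf) !ler_norml; lra.
  + apply: (@eq_of_dist_small _ _ _ (M (a%:C *: x) y + `|a| * M x y)) => e e0 e1.
    have [l [al al']] := approx_ex_scale a%:C x e0.
    have [m am] := ex y e e0.
    have h1 := hr' _ _ _ e0 e1 _ _ al' am; have h2 := hr' _ _ _ e0 e1 _ _ al am.
    have -> : r' (a%:C *: x) y - a * r' x y =
      - (r (a%:C *: l) m - r' (a%:C *: x) y) + a * (r l m - r' x y).
      by rewrite (formZl rf); ring.
    apply: le_trans (ler_normD _ _) _; rewrite normrN normrM mulrDr lerD //.
    by rewrite mulrCA ler_wpM2l.
- move=> k; apply: (@le_of_le_small _ _ _ (M k k)) => e e0 e1.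
  have [l al] := ex k e e0; have := hr' _ _ _ e0 e1 _ _ al al.
  have := r0 l; rewrite ler_norml; lra.
- move=> k; apply: (@le_of_le_small _ _ _ (M k k + 2 * nrm q k + 1)) => e e0 e1.
  have [l al] := ex k e e0; have := hr' _ _ _ e0 e1 _ _ al al.
  have h := approx_bound qf q0 (ltW e0) al.
  have : nrm q (V l) ^+ 2 <= (nrm q k + e) ^+ 2.
    by rewrite ler_pXn2r ?nnegrE ?nrm_ge0 // (le_trans _ h) ?nrm_ge0.
  rewrite sqrrD !sqr_nrm //; have := rq l.
  have : e ^+ 2 <= e by rewrite expr2 ler_piMl // ltW.
  by rewrite ler_norml; lra.
- move=> k; apply/esym.
  (* The vector [V k] lies in the range, so [k] is an admissible approximation for every
     tolerance. *)
  apply: (@eq_of_dist_small _ _ _ (M (V k) (V k))) => e e0 e1.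
  have ak : approxV e (V k) k.
    split=> // s _; rewrite subrr (form0l qf) normr0 mulr_ge0 ?nrm_ge0 //.
    exact: ltW.
  exact: (hr' _ _ _ e0 e1 _ _ ak ak).
- by move=> e k l e0 e1 al; apply: (hr' _ _ _ e0 e1 _ _ al al).
Qed.

End FormLimit.

(** * Hilbert space basics: real inner product, orthogonal complements, existence of projections *)

Lemma Re_real_mul (R : realType) (a : R) (z : complex R) :
  complex.Re (a%:C * z) = a * complex.Re z.
Proof. by case: z => u v /=; rewrite mul0r subr0. Qed.

Section HilbertTheory.
Variables (R : realType) (K : lmodType (complex R)) (ip : K -> K -> complex R).
Hypothesis hil : is_hilbert ip.

Definition rip (x y : K) : R := complex.Re (ip x y).

Lemma ip_scalel (c : complex R) x y : ip (c *: x) y = c * ip x y.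
Proof.
case: hil => ipl _ _ _ _.
have ip0 : ip 0 y = 0.
  by have := ipl (-1) 0 0 y; rewrite scaler0 addr0 mulN1r addNr.
by rewrite -[c *: x]addr0 ipl ip0 addr0.
Qed.

Lemma ip_scaler (c : complex R) x y : ip x (c *: y) = c^* * ip x y.
Proof.
case: (hil) => _ ipC _ _ _.
have -> : ip x (c *: y) = (ip (c *: y) x)^* by rewrite [LHS]ipC.
by rewrite ip_scalel rmorphM (ipC y x).
Qed.

Lemma rip_form : rform rip.
Proof.
case: (hil) => ipl ipC _ _ _; rewrite /rip.
split=> [x y z|x y|c x y|a x y].
- by have := ipl 1 x y z; rewrite scale1r mul1r => ->; case: (ip x z); case: (ip y z).
- by rewrite [ip x y]ipC; case: (ip y x).
- have -> : ip x (c^* *: y) = c * ip x y.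
    by rewrite ip_scaler; congr (_ * _); apply: conjcK.
  by rewrite ip_scalel.
- by rewrite ip_scalel; apply: Re_real_mul.
Qed.

Lemma rip_psd : psd rip.
Proof.
by case: hil => _ _ ip0 _ _ x; have := ip0 x; rewrite lecE => /andP[].
Qed.

Lemma hnormE x : hnorm ip x = nrm rip x. Proof. by []. Qed.

Lemma nrm_rip_eq0 x : nrm rip x <= 0 -> x = 0.
Proof.
move=> h; have {}h : rip x x = 0.
  rewrite -(sqr_nrm rip_psd); have -> : nrm rip x = 0.
    by apply/eqP; rewrite eq_le h nrm_ge0.
  by rewrite expr0n.
case: hil => _ _ ip0 ipd _; apply: ipd; move: (ip0 x) h.
rewrite lecE /rip; case: (ip x x) => u v /= /andP[/eqP -> _] -> //.
Qed.

Lemma eq_of_nrm_small x y M :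
  (forall e, 0 < e -> e <= 1 -> nrm rip (x - y) <= e * M) -> x = y.
Proof.
move=> h; apply/eqP; rewrite -subr_eq0; apply/eqP/nrm_rip_eq0.
by apply: (@le_of_le_small _ _ _ M) => e e0 e1; rewrite add0r h.
Qed.

(** Testing against ['i *: h] recovers the imaginary part of the inner product. *)
Lemma orthP (H : set K) (x : K) : subspace H ->
  (orth ip H x <-> forall h, H h -> rip x h = 0).
Proof.
move=> sH; split=> [o h Hh|o h Hh]; first by rewrite /rip (o h Hh).
have h1 := o _ Hh; have := o _ (subspaceZ sH 'i Hh).
rewrite /rip ip_scaler; move: h1; rewrite /rip; case: (ip x h) => u v /= -> h2.
by congr (_ +i* _); lra.
Qed.

Lemma subspace_orth (H : set K) : subspace H -> subspace (orth ip H).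
Proof.
move=> sH; split=> [|a x y /(orthP _ sH) ox /(orthP _ sH) oy].
  by apply/orthP => // h _; rewrite form0l //; exact: rip_form.
apply/orthP => // h Hh; rewrite (formDl rip_form) (formJ rip_form).
by rewrite ox ?oy ?addr0 //; apply: subspaceZ.
Qed.

Lemma orth_closed (H : set K) (x : K) : subspace H ->
  (forall e, 0 < e -> exists2 y, orth ip H y & nrm rip (x - y) <= e) ->
  orth ip H x.
Proof.
move=> sH h; apply/orthP => // z Hz.
apply: (@eq_of_dist_small _ _ _ (nrm rip z)) => e e0 _.
have [y /(orthP _ sH) oy ye] := h e e0.
rewrite subr0 -[x](subrK y) (formDl rip_form) oy // addr0.
apply: le_trans (form_CS rip_form rip_psd _ _) _.
by rewrite ler_wpM2r ?nrm_ge0.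
Qed.

Lemma invSn_small (e : R) : 0 < e ->
  exists N : nat, forall n, (N <= n)%N -> n.+1%:R^-1 < e.
Proof.
move=> e0; exists (Num.bound e^-1) => n Nn.
rewrite -[e]invrK ltf_pV2 ?posrE ?invr_gt0 //.
apply: lt_trans (archi_boundP _) _; first by rewrite ltW ?invr_gt0.
by rewrite ltr_nat.
Qed.

(** By domination and [approx_diff] the values [G l] are Cauchy as the tolerance shrinks. With [f]
    and [G] the identity, [g] is the projection onto [D]; with [f = V], it is the value at [k] of
    the extension of [G] from the range of [V]. *)
Lemma approx_lim (D : set K) (f G : K -> K) (q : K -> K -> R) :
  subspace D -> linear_on D f -> linear_on D G -> rform q -> psd q ->
  (forall l, D l -> nrm rip (G l) <= nrm q (f l)) ->
  forall k, exists g, forall e l, 0 < e -> approx D f q e k l ->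
    nrm rip (G l - g) <= e.
Proof.
move=> sD lf lG qf q0 Gq k.
have i1 n : 0 < n.+1%:R^-1 :> R by rewrite invr_gt0 ltr0n.
have [l hl] := choice (fun n : nat => approx_ex sD lf qf q0 k (i1 n)).
have Gd e d x y : 0 <= e -> 0 <= d -> approx D f q e k x -> approx D f q d k y ->
    nrm rip (G x - G y) <= e + d.
  move=> e0 d0 ax ay; have [[Dx _] [Dy _]] := (ax, ay).
  rewrite -(linear_onB sD lG) //.
  apply: le_trans (Gq _ (subspaceB sD Dx Dy)) _; exact: approx_diff ax ay.
have i0 n : 0 <= n.+1%:R^-1 :> R by rewrite invr_ge0 ler0n.
have [g hg] : exists g, converges_to ip (fun n => G (l n)) g.
  case: hil => _ _ _ _; apply => e e0.
  have [|N hN] := @invSn_small (e / 2); first by rewrite divr_gt0.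
  exists N => m n Nm Nn; rewrite hnormE.
  apply: le_lt_trans (Gd _ _ _ _ _ _ (hl m) (hl n)) _ => //.
  by rewrite [ltRHS]splitr ltrD ?hN.
exists g => e x e0 ax; apply: (@le_of_le_small _ _ _ 2) => d d0 d1.
have [N hN] := hg d d0; have [N' hN'] := invSn_small d0.
set n := maxn N N'.
have {}hN := hN n (leq_maxl _ _); have {}hN' := hN' n (leq_maxr _ _).
rewrite -(subrK (G (l n)) (G x)) -addrA.
apply: le_trans (nrmD rip_form rip_psd _ _) _.
move: hN hN' (Gd _ _ _ _ (ltW e0) (i0 n) ax (hl n)); rewrite hnormE.
by move: (n.+1%:R^-1) => i; lra.
Qed.

Lemma closed_subspace_subspace (H : set K) : closed_subspace ip H -> subspace H.
Proof. by case=> H0 HD HZ _; split=> // a x y Hx Hy; apply: HD => //; apply: HZ. Qed.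

Lemma proj_ex (H : set K) : closed_subspace ip H -> forall k, exists y, is_proj ip H k y.
Proof.
move=> cH k; have sH := closed_subspace_subspace cH.
have lid : linear_on H id by [].
have [g hg] := approx_lim sH lid lid rip_form rip_psd (fun l _ => lexx _) k.
have ex e := approx_ex sH lid rip_form rip_psd k (e := e).
exists g; split.
  have i1 n : 0 < n.+1%:R^-1 :> R by rewrite invr_gt0 ltr0n.
  have [l hl] := choice (fun n : nat => ex _ (i1 n)).
  case: cH => _ _ _ /(_ l g); apply=> [n|e e0]; first by case: (hl n).
  have [N hN] := invSn_small e0; exists N => n Nn; rewrite hnormE.
  apply: le_lt_trans (hN _ Nn); exact: hg (hl n).
apply/orthP => // h Hh.
apply: (@eq_of_dist_small _ _ _ (2 * nrm rip h)) => e e0 _.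
have [l al] := ex e e0; rewrite subr0.
have -> : k - g = (k - l) + (l - g) by rewrite addrA subrK.
rewrite (formDl rip_form); apply: le_trans (ler_normD _ _) _.
case: (al) => _ /(_ h Hh); have := form_CS rip_form rip_psd (l - g) h.
have := hg _ _ e0 al => h1 h2 h3.
have : nrm rip (l - g) * nrm rip h <= e * nrm rip h by rewrite ler_wpM2r ?nrm_ge0.
lra.
Qed.

End HilbertTheory.

(** * Calculus of the projection relation *)

Section Projection.
Variables (R : realType) (K : lmodType (complex R)) (ip : K -> K -> complex R).
Variable (H : set K).
Hypotheses (hil : is_hilbert ip) (cH : closed_subspace ip H).

Let rf := rip_form hil.
Let r0 := rip_psd hil.
Let sH := closed_subspace_subspace cH.
Let sO := subspace_orth hil sH.

Lemma rip_orth x y : H x -> orth ip H y -> rip ip x y = 0.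
Proof. by move=> Hx oy; rewrite (formC rf) /rip (oy x Hx). Qed.

Lemma is_proj_uniq x y z : is_proj ip H x y -> is_proj ip H x z -> y = z.
Proof.
move=> [Hy oy] [Hz oz]; apply/eqP; rewrite -subr_eq0; apply/eqP.
apply: (nrm_rip_eq0 hil); rewrite /nrm rip_orth ?sqrtr0 //; first exact: (subspaceB sH).
have -> : y - z = (x - z) - (x - y) by rewrite opprB [RHS]addrC addrA subrK.
exact: (subspaceB sO oz oy).
Qed.

Lemma is_proj_id x : H x -> is_proj ip H x x.
Proof. by move=> Hx; split=> //; rewrite subrr; case: sO. Qed.

Lemma is_proj_orth x : orth ip H x -> is_proj ip H x 0.
Proof. by move=> ox; split; [case: sH | rewrite subr0]. Qed.

Lemma is_proj_lin (a : complex R) x y x' y' : is_proj ip H x y ->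
  is_proj ip H x' y' -> is_proj ip H (a *: x + x') (a *: y + y').
Proof.
move=> [Hy oy] [Hy' oy']; split; first by case: sH => _; apply.
by rewrite opprD addrACA -scalerBr; case: sO => _; apply.
Qed.

(** The lifting property in the form [P V = T P], which can be iterated and so yields the identities
    for powers. *)
Lemma is_proj_lifting V T x y : linear_on setT V -> lifting ip H V T ->
  is_proj ip H x y -> is_proj ip H (V x) (T y).
Proof.
move=> lV [VO VH] [Hy oy]; have [HT oT] := VH _ Hy; split=> //.
have -> : V x - T y = V (x - y) + (V y - T y).
  by rewrite (linear_onB (subspaceT _) lV) // addrA subrK.
by apply: (subspaceD sO) => //; apply: VO.
Qed.

Lemma is_proj_sqr x y : is_proj ip H x y ->
  rip ip x x = rip ip y y + rip ip (x - y) (x - y).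
Proof.
move=> [Hy oy].
have -> : rip ip x x = rip ip (y + (x - y)) (y + (x - y)).
  by rewrite addrC subrK.
by rewrite [LHS](form_sqrD rf) (rip_orth Hy oy) mulr0 addr0.
Qed.

End Projection.

(** * Construction of the successive layers of the lifting *)

Section Step.
Variables (R : realType) (K : lmodType (complex R)) (ip : K -> K -> complex R).
Variables (H : set K) (V B : K -> K).
Hypotheses (hil : is_hilbert ip) (sH : subspace H).
Hypotheses (lV : linear_on setT V) (lB : linear_on setT B).
Hypothesis Bc : forall x, nrm (rip ip) (B x) <= nrm (rip ip) x.

Let rf := rip_form hil.
Let r0 := rip_psd hil.
Let sT := subspaceT K.

(* [slack], [weight] and [corr] are [q_n], [r_n] and [G_n]. *)
Record layer := Layer {
  slack : K -> K -> R;
  weight : K -> K -> R;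
  corr : K -> K }.

(** The fourth clause gives the domination of [weight] by [slack] along [V] that [form_lim]
    requires. The fifth is contractivity of the row made of [corr] and [B] on the complement of [H],
    with [weight] in place of the squared norm in the defect space. *)
Definition layer_ok (s : layer) : Prop :=
  [/\ rform (slack s) /\ psd (slack s), rform (weight s) /\ psd (weight s),
      linear_on setT (corr s) /\ (forall k, orth ip H (corr s k)),
      (forall l, slack s l l + weight s l l <= slack s (V l) (V l))
    & forall k x, orth ip H x ->
        rip ip (corr s k + B x) (corr s k + B x) <= weight s k k + rip ip x x].

(** Weight and correction are both extended from the range of [V] through the same approximate
    [q]-projections, so the row inequality survives the limit. *)
Lemma layer_step s : layer_ok s -> exists s', [/\ layer_ok s',
  (forall k, corr s' (V k) = corr s k)
  & forall k, slack s k k = slack s' k k + weight s' k k].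
Proof.
case: s => q r G [/= [qf q0] [wf w0] [lG oG] qrV row].
have B0 : B 0 = 0 by exact: linear_on0 sT lB.
have rq l : r l l <= q (V l) (V l) by have := qrV l; have := q0 l; lra.
have Gr l : rip ip (G l) (G l) <= r l l.
  (* The row inequality at [x = 0] bounds [G] by the weight. *)
  have o0 : orth ip H 0 by case: (subspace_orth hil sH).
  by have := row l 0 o0; rewrite B0 addr0 (form0l rf) addr0.
have Gq l : nrm (rip ip) (G l) <= nrm q (V l).
  by apply: ler_wsqrtr; exact: le_trans (Gr l) (rq l).
have [r' [rf' r0' rq' rV' rlim]] := form_lim lV qf q0 wf w0 rq.
have [G' hG'] := choice (approx_lim hil sT lV lG qf q0 (fun l _ => Gq l)).
have ex k e : 0 < e -> exists l, approx setT V q e k l.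
  exact: (approx_ex sT lV qf q0 k).
have GV k : G' (V k) = G k.
  apply/esym/(@eq_of_nrm_small _ _ _ hil _ _ 1) => e e0 e1; rewrite mulr1.
  apply: hG' => //; split=> // t _; rewrite subrr (form0l qf) normr0.
  by rewrite mulr_ge0 ?nrm_ge0 // ltW.
exists (Layer (fun x y => q x y - r' x y) r' G'); split=> //=; last by move=> k; ring.
split=> //=.
- split; first exact: formB.
  by move=> k; rewrite subr_ge0.
- split=> [a x y _ _|k].
    apply: (@eq_of_nrm_small _ _ _ hil _ _ (2 + Normc.normc a)) => e e0 _.
    have [l [l' [al al' all]]] := approx_ex_lin sT lV qf q0 a x y e0.
    have := hG' _ _ _ e0 al; have := hG' _ _ _ e0 al'; have := hG' _ _ _ e0 all.
    rewrite lG // => h1 h2 h3.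
    have -> : G' (a *: x + y) - (a *: G' x + G' y) =
       - (a *: G l + G l' - G' (a *: x + y)) + (a *: (G l - G' x) + (G l' - G' y)).
      by rewrite scalerBr [X in _ = _ + X]addrACA opprB -opprD [RHS]addrA subrK.
    apply: le_trans (nrmD rf r0 _ _) _; rewrite (nrmN rf).
    apply: le_trans (lerD h1 (nrmD rf r0 _ _)) _; rewrite (nrmZ rf).
    have : Normc.normc a * nrm (rip ip) (G l - G' x) <= Normc.normc a * e.
      by rewrite ler_wpM2l //; case: (a) => u v; apply: sqrtr_ge0.
    lra.
  apply: orth_closed => // e e0; have [l al] := ex k e e0.
  exists (G l) => //; rewrite (nrmB rf); exact: hG' al.
(* The new slack and weight add up to [q], and [r'] at [V l] equals [r] at [l], so this is the old
   inequality rearranged. *)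
- by move=> l; rewrite rV'; have := qrV l; lra.
- move=> k x ox; pose C := nrm q k + 1 + nrm (rip ip) x.
  (* [C] bounds the approximating row vector for all [e <= 1], and [M] is the rate in [form_lim];
     expanding the square of [e + nrm (rip ip) v] gives the constant below. *)
  pose M := nrm q k + nrm q k + 2.
  apply: (@le_of_le_small _ _ _ (1 + 2 * C + M)) => e e0 e1.
  have [l al] := ex k e e0.
  set u := G' k + B x; set v := G l + B x.
  have uv : nrm (rip ip) u <= e + nrm (rip ip) v.
    have -> : u = (G' k - G l) + v by rewrite /u /v addrA subrK.
    apply: le_trans (nrmD rf r0 _ _) _; rewrite lerD2r (nrmB rf).
    exact: hG' al.
  have vC : nrm (rip ip) v <= C.
    apply: le_trans (nrmD rf r0 _ _) _; apply: lerD (Bc x).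
    apply: le_trans (Gq l) (le_trans (approx_bound qf q0 (ltW e0) al) _).
    by rewrite lerD2l.
  have vr : nrm (rip ip) v ^+ 2 <= r l l + rip ip x x by rewrite sqr_nrm //; exact: row.
  have rl : r l l <= r' k k + e * M.
    by have := rlim _ _ _ e0 e1 al; rewrite ler_norml -/M; lra.
  have : nrm (rip ip) u ^+ 2 <= (e + nrm (rip ip) v) ^+ 2.
    by rewrite ler_pXn2r ?nnegrE ?addr_ge0 ?nrm_ge0 // ltW.
  have ee : e ^+ 2 <= e by rewrite expr2 ler_piMl // ltW.
  have ev : e * nrm (rip ip) v <= e * C by rewrite ler_wpM2l // ltW.
  rewrite sqr_nrm // sqrrD; lra.
Qed.

Lemma layer_seq s0 : layer_ok s0 -> exists st : nat -> layer,
  [/\ st 0%N = s0, (forall n, layer_ok (st n)),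
  (forall n k, corr (st n.+1) (V k) = corr (st n) k)
  & forall n k, slack (st n) k k = slack (st n.+1) k k + weight (st n.+1) k k].
Proof.
move=> ok0.
have ex s : exists s', layer_ok s -> [/\ layer_ok s',
    (forall k, corr s' (V k) = corr s k)
    & forall k, slack s k k = slack s' k k + weight s' k k].
  (* A layer violating the invariant is sent to itself, a default that makes the successor function
     total. *)
  have [ok|nok] := pselect (layer_ok s); last by exists s.
  by have [s' hs'] := layer_step ok; exists s'.
have [F hF] := choice ex.
have okn n : layer_ok (iter n F s0).
  by elim: n => //= n IH; case: (hF _ IH).
by exists (fun n => iter n F s0); split=> // n k; case: (hF _ (okn n)).
Qed.

End Step.

(** * The general lifting problem: initial layer and convergence of the series *)

Section Lift.
Variables (R : realType) (K : lmodType (complex R)) (ip : K -> K -> complex R).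
Variables (H : set K) (V T B A X : K -> K) (g : R).
Hypotheses (hil : is_hilbert ip) (cH : closed_subspace ip H).
Hypotheses (lV : linear_on setT V) (lB : linear_on setT B).
Hypothesis Viso : forall x, nrm (rip ip) (V x) = nrm (rip ip) x.
Hypothesis Bc : forall x, nrm (rip ip) (B x) <= nrm (rip ip) x.
Hypotheses (VT : lifting ip H V T) (BA : lifting ip H B A).
Hypotheses (XH : forall h, H h -> H (X h)) (lX : linear_on H X).
Hypothesis Xg : forall h, H h -> nrm (rip ip) (X h) <= g * nrm (rip ip) h.
Hypothesis g0 : 0 <= g.
Hypothesis XTA : forall h, H h -> X (T h) = A (X h).

Let rf := rip_form hil.
Let r0 := rip_psd hil.
Let sT := subspaceT K.
Let sH := closed_subspace_subspace cH.
Let sO := subspace_orth hil sH.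

Lemma rip_le_of_nrm x y : nrm (rip ip) x <= nrm (rip ip) y -> rip ip x x <= rip ip y y.
Proof. by move=> h; rewrite -!sqr_nrm // ler_pXn2r ?nnegrE ?nrm_ge0. Qed.

(** The sum over [i < m] of [B^i (corr (st (n + 1 + i)) k)] in Horner form, so that each unfolding
    is one use of the row inequality. *)
Fixpoint tail (st : nat -> layer K) (n m : nat) (k : K) : K :=
  if m is m'.+1 then corr (st n.+1) k + B (tail st n.+1 m' k) else 0.

Lemma nrm_iterB n x : nrm (rip ip) (iter n B x) <= nrm (rip ip) x.
Proof. by elim: n => //= n IH; apply: le_trans (Bc _) IH. Qed.

Lemma layer0 : exists W s0, [/\ layer_ok ip H V B s0, linear_on setT W,
  (forall k y, is_proj ip H k y -> W k = X y),
  (forall k, H (W k)) /\ (forall k, W (V k) + corr s0 k = B (W k))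
  & forall k, g ^+ 2 * rip ip k k = rip ip (W k) (W k) + slack s0 k k].
Proof.
have [P hP] := choice (proj_ex hil cH).
have uniq := is_proj_uniq hil cH.
have lP : linear_on setT P.
  by move=> a x y _ _; apply: (uniq (a *: x + y)) => //; apply: is_proj_lin.
have HP k : H (P k) by case: (hP k).
pose W k := X (P k); pose N k := P (B (W k)).
have HW k : H (W k) by apply: XH.
have lW : linear_on setT W by move=> a x y _ _; rewrite /W lP // lX.
have lBW : linear_on setT (fun k => B (W k)) by move=> a x y _ _; rewrite lW // lB.
have lN : linear_on setT N by move=> a x y _ _; rewrite /N lBW // lP.
have NA k : N k = A (W k).
  by apply: (uniq (B (W k))) => //; case: BA => _; apply.
(* [X P V = X T P = A X P]. *)
have WV k : W (V k) = N k.
  rewrite NA /W -XTA //; congr X; apply: (uniq (V k)) => //.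
  exact: is_proj_lifting.
have PV k : rip ip (P k) (P k) <= rip ip k k.
  by rewrite (is_proj_sqr hil (hP k)) lerDl.
pose G k := B (W k) - N k.
have oG k : orth ip H (G k) by case: (hP (B (W k))).
have lG : linear_on setT G.
  move=> a x y _ _; rewrite /G lBW // lN // scalerBr.
  by rewrite opprD addrACA.
pose q x y := g ^+ 2 * rip ip x y - rip ip (W x) (W y).
pose r x y := rip ip (W x) (W y) - rip ip (N x) (N y).
exists W, (Layer q r G); split=> //=; last 1 first.
- by move=> k; rewrite /q; ring.
- split=> /=.
  + split; first by apply: formB; [apply: form_scale | apply: form_comp].
    move=> k; rewrite /q subr_ge0 -(sqr_nrm r0) -(sqr_nrm r0) -exprMn.
    rewrite ler_pXn2r ?nnegrE ?mulr_ge0 ?nrm_ge0 //.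
    apply: le_trans (Xg (HP k)) _; rewrite ler_wpM2l //.
    exact: ler_wsqrtr.
  + split; first by apply: formB; apply: form_comp.
    move=> k; rewrite /r subr_ge0; apply: le_trans (PV _) _.
    exact: rip_le_of_nrm.
  + by [].
  (* Equality holds here: both sides are [g^2 |l|^2 - |N l|^2], as [V] is isometric. *)
  + move=> l; rewrite /q /r WV.
    by rewrite -(sqr_nrm r0 (V l)) Viso sqr_nrm //; lra.
  (* Contractivity of [B] at [W k + x], with both sides split by Pythagoras; the component of the
     image in [H] is [N k]. *)
  + move=> k x ox.
    have pr : is_proj ip H (B (W k + x)) (N k).
      split; [exact: HP | rewrite (linear_onD lB) // addrAC].
      by apply: (subspaceD sO) (oG k) _; case: BA => BO _; apply: BO.
    have := is_proj_sqr hil pr; have := rip_le_of_nrm (Bc (W k + x)).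
    have -> : B (W k + x) - N k = G k + B x by rewrite (linear_onD lB) // addrAC.
    rewrite (form_sqrD rf) (rip_orth hil (HW k) ox) /r; lra.
- by move=> k y pr; rewrite /W (uniq _ _ _ pr (hP k)).
- by split=> // k; rewrite WV /G addrC subrK.
Qed.

(** [Y] is the pointwise limit of the partial sums [Yp]. These already satisfy the norm bound, and
    the intertwining up to a shift of the index. *)
Lemma lifting_ex : exists Y, [/\ linear_on setT Y,
  (forall k, nrm (rip ip) (Y k) <= g * nrm (rip ip) k),
  lifting ip H Y X & forall k, Y (V k) = B (Y k)].
Proof.
have [W [s0 [ok0 lW WP [HW WVB] qW]]] := layer0.
have [st [st0 ok corrV slackS]] := layer_seq hil sH lV lB Bc ok0.
have q0 n k : 0 <= slack (st n) k k by case: (ok n) => -[].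
have oS n m k : orth ip H (tail st n m k).
  elim: m n => [|m IH] n /=; first by case: sO.
  apply: (subspaceD sO); first by case: (ok n.+1) => _ _ [].
  by case: BA => BO _; apply: BO.
(* The row inequality applied to the next tail; the weights telescope into differences of slacks. *)
have nS n m k : rip ip (tail st n m k) (tail st n m k) <=
    slack (st n) k k - slack (st (n + m)%N) k k.
  elim: m n => [|m IH] n /=; first by rewrite addn0 (form0l rf) subrr.
  have [_ _ _ _ row] := ok n.+1.
  have := row k _ (oS n.+1 m k); have := IH n.+1; rewrite (slackS n) addSnnS; lra.
have lS n m : linear_on setT (tail st n m).
  elim: m n => [|m IH] n a x y _ _ /=; first by rewrite scaler0 addr0.
  have [_ _ [lG _] _ _] := ok n.+1.
  by rewrite lG // IH // lB // scalerDr addrACA.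
have SV n m k : tail st n.+1 m (V k) = tail st n m k.
  by elim: m n => //= m IH n; rewrite IH corrV.
have SD n m p k : tail st p (n + m) k = tail st p n k + iter n B (tail st (p + n)%N m k).
  elim: n p => [|n IH] p /=; first by rewrite add0r addn0.
  by rewrite IH (linear_onD lB) // addrA addSnnS.
pose Yp n k := W k + tail st 0 n k.
have lYp n : linear_on setT (Yp n).
  by move=> a x y _ _; rewrite /Yp lW // lS // scalerDr addrACA.
have YpV n k : Yp n.+1 (V k) = B (Yp n k).
  by rewrite /Yp /= SV corrV st0 addrA WVB (linear_onD lB).
have Ypn n k : nrm (rip ip) (Yp n k) <= g * nrm (rip ip) k.
  rewrite -(@ler_pXn2r _ 2) ?nnegrE ?mulr_ge0 ?nrm_ge0 // exprMn !sqr_nrm //.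
  rewrite /Yp (form_sqrD rf) (rip_orth hil (HW k) (oS _ _ _)) qW -st0.
  by have := nS 0%N n k; have := q0 (0 + n)%N k; lra.
have /choice[Y hY] k : exists l, converges_to ip (fun n => Yp n k) l.
  case: (hil) => _ _ _ _; apply => e e0.
  have e3 : 0 < e / 3 by rewrite divr_gt0.
  set E := [set slack (st n) k k | n in [set: nat]].
  have Einf : has_inf E.
    by split; [exists (slack (st 0%N) k k), 0%N | exists 0 => _ [n _ <-]].
  (* The slacks decrease and are bounded below. The tolerance is squared because slack differences
     bound squared norms of tails. *)
  have [_ [N _ <-] hN] := inf_adherent (exprn_gt0 2 e3) Einf.
  have near n : (N <= n)%N -> nrm (rip ip) (Yp n k - Yp N k) <= e / 3.
    move=> Nn; rewrite -(subnKC Nn); set m := (n - N)%N.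
    have -> : Yp (N + m)%N k - Yp N k = iter N B (tail st N m k).
      by rewrite /Yp SD [W k + (_ + _)]addrA [LHS]addrAC subrr !add0r.
    apply: le_trans (nrm_iterB _ _) (ler_sqrtl (ltW e3) _).
    have : inf E <= slack (st (N + m)%N) k k.
      by apply: ge_inf; [case: Einf | exists (N + m)%N].
    have := nS N m k; lra.
  exists N => m n Nm Nn; rewrite hnormE.
  have -> : Yp m k - Yp n k = (Yp m k - Yp N k) - (Yp n k - Yp N k).
    by rewrite opprB addrA subrK.
  apply: le_lt_trans (nrmD rf r0 _ _) _; rewrite (nrmN rf).
  by have := near _ Nm; have := near _ Nn; lra.
have lim k e : 0 < e -> exists N, forall n, (N <= n)%N ->
    nrm (rip ip) (Yp n k - Y k) <= e.
  by move=> e0; have [N hN] := hY k e e0; exists N => n /hN/ltW.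
have oY k : orth ip H (Y k - W k).
  apply: orth_closed => // e e0; have [N /(_ N (leqnn N)) hN] := lim k e e0.
  exists (tail st 0 N k) => //; rewrite (nrmB rf).
  have -> : tail st 0 N k - (Y k - W k) = Yp N k - Y k by rewrite /Yp opprB addrCA addrA.
  by [].
exists Y; split.
- move=> a x y _ _.
  apply: (@eq_of_nrm_small _ _ _ hil _ _ (2 + Normc.normc a)) => e e0 _.
  have [N1 h1] := lim (a *: x + y) e e0.
  have [N2 h2] := lim x e e0; have [N3 h3] := lim y e e0.
  pose n := maxn N1 (maxn N2 N3).
  have {}h1 := h1 n (leq_maxl _ _).
  have {}h2 : nrm (rip ip) (Yp n x - Y x) <= e.
    by apply: h2; rewrite /n maxnCA leq_maxl.
  have {}h3 : nrm (rip ip) (Yp n y - Y y) <= e.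
    by apply: h3; rewrite /n maxnA leq_maxr.
  have -> : Y (a *: x + y) - (a *: Y x + Y y) =
     - (Yp n (a *: x + y) - Y (a *: x + y)) + (a *: (Yp n x - Y x) + (Yp n y - Y y)).
    rewrite lYp // scalerBr [X in _ = _ + X]addrACA opprB -opprD.
    by rewrite [RHS]addrA subrK.
  apply: le_trans (nrmD rf r0 _ _) _; rewrite (nrmN rf).
  apply: le_trans (lerD h1 (nrmD rf r0 _ _)) _; rewrite (nrmZ rf).
  have : Normc.normc a * nrm (rip ip) (Yp n x - Y x) <= Normc.normc a * e.
    by rewrite ler_wpM2l //; case: (a) => u v; apply: sqrtr_ge0.
  lra.
- move=> k; apply: (@le_of_le_small _ _ _ 1) => e e0 _.
  have [N /(_ N (leqnn N)) hN] := lim k e e0.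
  rewrite -(subrK (Yp N k) (Y k)); apply: le_trans (nrmD rf r0 _ _) _.
  by rewrite (nrmB rf); have := Ypn N k; lra.
- split=> [x ox|h Hh].
    (* [W] vanishes on the complement of [H], while [Y - W] takes values in it. *)
    have -> : Y x = (Y x - W x) + 0.
      have <- : W x = 0.
        by rewrite (WP x 0) ?(linear_on0 sH lX) //; apply: is_proj_orth.
      by rewrite subrK.
    by rewrite addr0.
  by split; [exact: XH | rewrite -(WP h h) //; apply: is_proj_id].
- move=> k; apply: (@eq_of_nrm_small _ _ _ hil _ _ 2) => e e0 _.
  have [N1 h1] := lim (V k) e e0; have [N2 h2] := lim k e e0.
  pose n := maxn N1 N2.
  have {}h1 : nrm (rip ip) (Yp n.+1 (V k) - Y (V k)) <= e.
    by apply: h1; rewrite leqW // leq_maxl.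
  have {}h2 : nrm (rip ip) (Yp n k - Y k) <= e by apply: h2; rewrite leq_maxr.
  have -> : Y (V k) - B (Y k) = - (Yp n.+1 (V k) - Y (V k)) + B (Yp n k - Y k).
    by rewrite YpV (linear_onB sT lB) // opprB addrA subrK.
  apply: le_trans (nrmD rf r0 _ _) _; rewrite (nrmN rf).
  have := Bc (Yp n k - Y k); lra.
Qed.

End Lift.

(** * The operator norm as the best bound *)

Section OpNorm.
Variables (R : realType) (K : lmodType (complex R)) (ip : K -> K -> complex R).
Hypothesis hil : is_hilbert ip.

Let rf := rip_form hil.
Let r0 := rip_psd hil.

Lemma opnorm_on_le (H : set K) (A : K -> K) (M : R) : subspace H -> 0 <= M ->
  (forall h, H h -> hnorm ip (A h) <= M * hnorm ip h) -> opnorm_on ip H A <= M.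
Proof.
move=> [H0 _] M0 AM; apply: ge_sup.
  by exists (hnorm ip (A 0)), 0 => //; split=> //; rewrite hnormE (nrm0 rf) ler01.
move=> _ [h [Hh h1] <-]; apply: le_trans (AM h Hh) _.
by rewrite -[leRHS]mulr1 ler_wpM2l.
Qed.

Lemma has_ubound_opnorm (H : set K) (A : K -> K) : bounded_op_on ip H A ->
  has_ubound [set hnorm ip (A h) | h in [set h | H h /\ hnorm ip h <= 1]].
Proof.
move=> [_ _ [M AM]]; exists `|M| => _ [h [Hh h1] <-].
apply: le_trans (AM h Hh) _; apply: le_trans (_ : `|M| * hnorm ip h <= _).
  by rewrite ler_wpM2r ?sqrtr_ge0 // ler_norm.
by rewrite -[leRHS]mulr1 ler_wpM2l.
Qed.

Lemma opnorm_on_ge (H : set K) (A : K -> K) h : bounded_op_on ip H A ->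
  H h -> hnorm ip h <= 1 -> hnorm ip (A h) <= opnorm_on ip H A.
Proof.
by move=> Ab Hh h1; apply: ub_le_sup; [exact: has_ubound_opnorm | exists h].
Qed.

Lemma opnorm_on_ge0 (H : set K) (A : K -> K) : bounded_op_on ip H A ->
  subspace H -> 0 <= opnorm_on ip H A.
Proof.
move=> Ab [H0 _]; apply: le_trans (_ : hnorm ip (A 0) <= _); first exact: sqrtr_ge0.
by apply: opnorm_on_ge => //; rewrite hnormE (nrm0 rf) ler01.
Qed.

Lemma hnorm_le_opnorm (H : set K) (A : K -> K) h : bounded_op_on ip H A ->
  subspace H -> H h -> hnorm ip (A h) <= opnorm_on ip H A * hnorm ip h.
Proof.
move=> Ab sH Hh; have [_ lA [M AM]] := Ab.
have [h0|hn] := eqVneq (hnorm ip h) 0.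
  by rewrite h0 mulr0; have := AM h Hh; rewrite h0 mulr0.
have hp : 0 < hnorm ip h by rewrite lt_def hn sqrtr_ge0.
have nn : Normc.normc (hnorm ip h)^-1%:C = (hnorm ip h)^-1.
  rewrite /= expr0n /= addr0 sqrtr_sqr ger0_norm //.
  by rewrite invr_ge0 ltW.
have := opnorm_on_ge Ab (subspaceZ sH (hnorm ip h)^-1%:C Hh).
rewrite (linear_onZ sH lA) // !hnormE !(nrmZ rf) nn -!hnormE mulVf // => /(_ (lexx _)).
by rewrite mulrC ler_pdivrMr.
Qed.

End OpNorm.

(** * Assembly of the three cases *)

(** Two liftings appear: [V] enters the identities for powers, the isometry [V'] the intertwining.
    They differ only in case (iii). The norm of [Y] is at least that of [X] since [X h] is the
    projection of [Y h]. *)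
Lemma lifting_conclusion (R : realType) (K : lmodType (complex R))
    (ip : K -> K -> complex R) (H : set K) (T V X V' T' B A : K -> K)
    (rel : (K -> K) -> Prop) :
  is_hilbert ip -> closed_subspace ip H ->
  linear_on setT V -> lifting ip H V T ->
  bounded_op_on ip H X ->
  linear_on setT V' -> (forall x, hnorm ip (V' x) = hnorm ip x) ->
  lifting ip H V' T' ->
  linear_on setT B -> (forall x, hnorm ip (B x) <= hnorm ip x) ->
  lifting ip H B A ->
  (forall h, H h -> X (T' h) = A (X h)) ->
  (forall Y, (forall x, Y (V' x) = B (Y x)) -> rel Y) ->
  exists Y : K -> K,
    [/\ bounded_op ip Y /\ lifting ip H Y X, rel Y,
        (forall (n m : nat) (h : K), H h ->
           is_proj ip H (iter n V (iter m Y h)) (iter n T (iter m X h))),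
        (forall (n m : nat) (h : K), H h ->
           is_proj ip H (iter n Y (iter m V h)) (iter n X (iter m T h)))
      & opnorm_on ip setT Y = opnorm_on ip H X].
Proof.
move=> hil cH lV VT Xb lV' V'iso VT' lB Bc BA XTA relP.
have sH := closed_subspace_subspace cH.
have [XH lX _] := Xb.
have g0 := opnorm_on_ge0 hil Xb sH.
have [Y [lY Yg YX YB]] := lifting_ex hil cH lV' lB V'iso Bc VT' BA XH lX
  (fun h Hh => hnorm_le_opnorm hil Xb sH Hh) g0 XTA.
have Yb : bounded_op ip Y by split=> //; exists (opnorm_on ip H X) => h _; exact: Yg.
have iterP S S' n x y : linear_on setT S -> lifting ip H S S' ->
    is_proj ip H x y -> is_proj ip H (iter n S x) (iter n S' y).
  by move=> lS SS' pr; elim: n => //= n IH; apply: is_proj_lifting.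
exists Y; split=> //; first exact: relP.
- move=> n m h Hh; apply: (iterP _ _ n) => //.
  by apply: (iterP _ _ m) => //; apply: is_proj_id.
- move=> n m h Hh; apply: (iterP _ _ n) => //.
  by apply: (iterP _ _ m) => //; apply: is_proj_id.
- apply/eqP; rewrite eq_le; apply/andP; split.
    by apply: opnorm_on_le => // h _; exact: Yg.
  apply: opnorm_on_le => //; first exact: opnorm_on_ge0.
  move=> h Hh; apply: le_trans (hnorm_le_opnorm hil Yb _ I) => //.
  rewrite !hnormE; apply: ler_wsqrtr.
  by rewrite (is_proj_sqr hil (proj2 YX h Hh)) lerDl; exact: rip_psd.
Qed.

(** Polarisation. *)
Lemma isometry_rip (R : realType) (K : lmodType (complex R))
    (ip : K -> K -> complex R) (U : K -> K) x y : is_hilbert ip ->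
  linear_on setT U -> (forall x, hnorm ip (U x) = hnorm ip x) ->
  rip ip (U x) (U y) = rip ip x y.
Proof.
move=> hil lU Uiso; have rf := rip_form hil; have r0 := rip_psd hil.
have U2 z : rip ip (U z) (U z) = rip ip z z.
  by rewrite -!(sqr_nrm r0) -!hnormE Uiso.
have := U2 (x + y); rewrite (linear_onD lU) // !(form_sqrD rf) !U2; lra.
Qed.

Theorem mainTheorem3 (R : realType) (K : lmodType (complex R))
  (ip : K -> K -> complex R) (H : set K) (T V X Q Qb : K -> K) :
  is_hilbert ip ->
  closed_subspace ip H ->
  contraction_on ip H T ->
  isometry_on ip setT V -> lifting ip H V T ->
  bounded_op_on ip H X ->
  contraction_on ip H Q ->
  contraction_on ip setT Qb ->
  reduces ip H Qb ->
  (forall h, H h -> Qb h = Q h) ->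
  let conclusion (rel : (K -> K) -> Prop) :=
    exists Y : K -> K,
      [/\ bounded_op ip Y /\ lifting ip H Y X, rel Y,
          (forall (n m : nat) (h : K), H h ->
             is_proj ip H (iter n V (iter m Y h)) (iter n T (iter m X h))),
          (forall (n m : nat) (h : K), H h ->
             is_proj ip H (iter n Y (iter m V h)) (iter n X (iter m T h)))
        & opnorm_on ip setT Y = opnorm_on ip H X] in
  [/\
   (* (i) *)
   (forall h, H h -> X (T h) = Q (T (X h))) ->
     conclusion (fun Y => forall x, Y (V x) = Qb (V (Y x))),
   (* (ii) *)
   (forall h, H h -> X (T h) = T (Q (X h))) ->
     conclusion (fun Y => forall x, Y (V x) = V (Qb (Y x)))
 & (* (iii) *)
   unitary_on ip H Q -> unitary_on ip setT Qb ->
   (forall h, H h -> X (T h) = T (X (Q h))) ->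
     conclusion (fun Y => forall x, Y (V x) = V (Y (Qb x)))].
Proof.
move=> hil cH [[TH lT _] _] [[_ lV _] Viso] VT Xb _ [[_ lQb _] Qbc] [QbH QbO] QbQ.
have sH := closed_subspace_subspace cH.
have {}Viso x : hnorm ip (V x) = hnorm ip x by exact: Viso.
have {}Qbc x : hnorm ip (Qb x) <= hnorm ip x by exact: Qbc.
have sO := subspace_orth hil sH.
have [VO VH] := VT.
move=> conclusion; split.
- move=> XT; apply: (@lifting_conclusion _ _ _ _ _ _ _ V T
    (fun x => Qb (V x)) (fun x => Q (T x))) => //.
  + by move=> a x y _ _; rewrite lV // lQb.
  + by move=> x; apply: le_trans (Qbc _) _; rewrite Viso.
  + split=> [x ox|h Hh]; first by apply/QbO/VO.
    have [HTh oTh] := VH h Hh; rewrite -QbQ //; split; first exact: QbH.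
    by rewrite -(linear_onB (subspaceT _) lQb) //; apply: QbO.
- move=> XT; apply: (@lifting_conclusion _ _ _ _ _ _ _ V T
    (fun x => V (Qb x)) (fun x => T (Q x))) => //.
  + by move=> a x y _ _; rewrite lQb // lV.
  + by move=> x; rewrite Viso.
  + split=> [x ox|h Hh]; first by apply/VO/QbO.
    by rewrite -QbQ //; apply/VH/QbH.
- move=> [_ Qs] [[_ Qbiso] Qbs] XT.
  have {}Qbiso x : hnorm ip (Qb x) = hnorm ip x by exact: Qbiso.
  (* [S] is the inverse of [Qb]. *)
  have /choice[S hS] x : exists y, Qb y = x.
    by have [y _ <-] := Qbs x I; exists y.
  have Qbi x y : Qb x = Qb y -> x = y.
    move=> xy; apply/eqP; rewrite -subr_eq0; apply/eqP/(nrm_rip_eq0 hil).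
    rewrite -hnormE -Qbiso (linear_onB (subspaceT _) lQb) // xy subrr hnormE.
    by rewrite (nrm0 (rip_form hil)).
  have SK x : S (Qb x) = x by apply: Qbi; rewrite hS.
  have lS : linear_on setT S.
    by move=> a x y _ _; apply: Qbi; rewrite lQb // !hS.
  (* Surjectivity of [Q] on [H] keeps the preimage inside [H]. *)
  have SH h : H h -> H (S h).
    by move=> Hh; have [y Hy <-] := Qs h Hh; rewrite -QbQ // SK.
  apply: (@lifting_conclusion _ _ _ _ _ _ _ (fun x => V (S x)) (fun x => T (S x))
    V T) => //.
  + by move=> a x y _ _; rewrite lS // lV.
  + by move=> x; rewrite Viso -Qbiso hS.
  + split=> [x ox|h Hh]; last by apply/VH/SH.
    (* The inner product of [S x] and [h] equals that of [x] and [Qb h], and [Qb h] lies in [H]. *)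
    apply: VO; apply/(orthP hil _ sH) => h Hh.
    rewrite -(isometry_rip _ _ hil lQb Qbiso) hS.
    by move/(orthP hil _ sH): ox; apply; apply: QbH.
  + by move=> x; rewrite Viso.
  + by move=> h Hh; rewrite XT; [rewrite -QbQ ?hS //; apply: SH | apply: SH].
  (* The relation [Y V S = V Y] is evaluated at [Qb x]. *)
  + by move=> Y YV x; rewrite -YV SK.
Qed.
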